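(* Let $N\ge 2$ be an even integer. If $t\in\mathrm{TNS}'(G_{2\times N},2,2)\subset(\mathbb{C}^2)^{\otimes 2N}$ is generic, then its border rank satisfies $\underline{R}(t)\ge 2^{N-1}$.
   Context: The graph $G_{2\times N}$ (the $2\times N$ grid on a torus) has $2N$ vertices: upper vertices $1,\dots,N$ and lower vertices $1',\dots,N'$, with column indices read modulo $N$. Every vertex is incident to five edges: an up edge, a right edge, a down edge, a left edge, and one dangling edge (an edge attached to only one vertex), called the physical edge. The right edge of $p$ is the left edge of $p+1$, and the right edge of $p'$ is the left edge of $(p+1)'$ (indices modulo $N$); the down edge of $p$ is the up edge of $p'$, and the down edge of $p'$ is the up edge of $p$ (so $p$ and $p'$ are joined by two distinct edges; likewise for $N=2$ horizontal neighbours are joined by two distinct edges). These $4N$ non-dangling edges are the entanglement edges, and there are $2N$ physical edges. Bound tensor network state $\mathrm{TNS}'(G_{2\times N},d,k)$: put $\mathbf V=\mathbb{C}^k\otimes U\otimes R\otimes D\otimes L$, where $\mathbb{C}^k$ belongs to the physical edge, $U=L=\mathbb{C}^d$ belong to the up and left edges, and $R=D=(\mathbb{C}^d)^*$ belong to the right and down edges. For $T\in\mathbf V$, place a copy of the same tensor $T$ at each of the $2N$ vertices, take the tensor product of all copies, and for each entanglement edge contract the two corresponding factors (an $R$ factor with an $L$ factor for horizontal edges, a $D$ factor with a $U$ factor for vertical edges) using the natural pairing of $(\mathbb{C}^d)^*$ with $\mathbb{C}^d$. The result is a tensor $\phi(T)\in(\mathbb{C}^k)^{\otimes 2N}$, and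 $\mathrm{TNS}'(G_{2\times N},d,k)=\{\phi(T):T\in\mathbf V\}$. Rank and border rank: a tensor in $W_1\otimes\cdots\otimes W_l$ has rank one if it is of the form $w_1\otimes\cdots\otimes w_l$ with $w_j \in W_j$; the rank of a tensor is the smallest $r$ such that it is a sum of $r$ rank one tensors; the border rank $\underline{R}(t)$ is the smallest $r$ such that $t$ is a limit of tensors of rank $r$. Generic: a property holds for a generic $t\in\mathrm{TNS}'(G_{2\times N},d,k)$ if it holds for $\phi(T)$ for all $T$ in some nonempty Zariski open subset of the complex vector space $\mathbf V$. *)

(* Defs.v *)
From HB Require Import structures.
From mathcomp Require Import all_boot all_order all_algebra.
From mathcomp Require Import complex.
From mathcomp Require Import all_classical all_reals all_analysis.
(* mpoly is not imported: its notations clash with those of analysis. *)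
From mathcomp Require mpoly.

Set Implicit Arguments.
Unset Strict Implicit.
Unset Printing Implicit Defensive.

Import Order.TTheory GRing.Theory Num.Theory.
Import numFieldNormedType.Exports.
Local Open Scope classical_set_scope.
Local Open Scope ring_scope.
Local Open Scope complex_scope.

(* The tensor product of one copy of C^k for each v : V, in coordinates: the
   function x : V -> 'I_k indexes the basis tensor which has the x v-th standard
   basis vector of C^k as its factor at v. *)
Definition tensor (R : realType) (V : finType) (k : nat) :=
  {ffun {ffun V -> 'I_k} -> R[i]}.

Definition simple_tensor (R : realType) (V : finType) (k : nat)
    (w : V -> {ffun 'I_k -> R[i]}) : tensor R V k :=
  [ffun x : {ffun V -> 'I_k} => \prod_(v : V) w v (x v)].

Definition rank_one (R : realType) (V : finType) (k : nat)
    (t : tensor R V k) : Prop :=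
  exists w : V -> {ffun 'I_k -> R[i]}, t = simple_tensor w.

(* 0 if P is empty, which for the two sets below does not happen when V is
   nonempty. *)
Definition least (P : set nat) : nat :=
  xget 0%N [set r | P r /\ (forall s, P s -> (r <= s)%N)].

Definition tensor_rank (R : realType) (V : finType) (k : nat)
    (t : tensor R V k) : nat :=
  least [set r | exists s : 'I_r -> tensor R V k,
                   (forall i, rank_one (s i)) /\ t = \sum_(i < r) s i].

(* The tensor space is finite dimensional, so convergence is convergence of all
   coordinates. The complex numbers carry the topology of their norm through
   the alias R[i]^o. *)
Definition tensor_limit (R : realType) (V : finType) (k : nat)
    (s : nat -> tensor R V k) (t : tensor R V k) : Prop :=
  forall x : {ffun V -> 'I_k},
    (fun n => s n x : R[i]^o) @ \oo --> (t x : R[i]^o).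

Definition border_rank (R : realType) (V : finType) (k : nat)
    (t : tensor R V k) : nat :=
  least [set r | exists s : nat -> tensor R V k,
                   (forall n, tensor_rank (s n) = r) /\ tensor_limit s t].

(* Vertices of the 2 x N grid on a torus: (p, false) is the upper vertex p and
   (p, true) is the lower vertex p'. *)
Definition vertex (N : nat) := ('I_N * bool)%type.

(* Every entanglement edge is the right edge or the down edge of exactly one
   vertex, so inl v stands for the right edge of v and inr v for the down edge
   of v. Parallel edges are thereby kept distinct. *)
Definition ent_edge (N : nat) := (vertex N + vertex N)%type.

Definition right_edge (N : nat) (v : vertex N) : ent_edge N := inl v.
Definition down_edge (N : nat) (v : vertex N) : ent_edge N := inr v.
Definition left_edge (N : nat) (v : vertex N) : ent_edge N :=
  right_edge (ord_pred v.1, v.2).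
Definition up_edge (N : nat) (v : vertex N) : ent_edge N :=
  down_edge (v.1, ~~ v.2).

(* C^k (x) U (x) R (x) D (x) L in coordinates, in this order, with the standard
   basis of U = L = C^d and its dual basis in R = D = (C^d)^*. *)
Definition site_index (d k : nat) := ('I_k * 'I_d * 'I_d * 'I_d * 'I_d)%type.
Definition site_tensor (R : realType) (d k : nat) :=
  {ffun site_index d k -> R[i]}.

(* The natural pairing sends (e_i^*, e_j) to 1 if i = j and to 0 otherwise.
   Hence contracting all the entanglement edges leaves the terms in which the
   two factors of each edge have the same index e, summed over all e. *)
Definition tns (R : realType) (N d k : nat) (T : site_tensor R d k) :
    tensor R (vertex N) k :=
  [ffun x : {ffun vertex N -> 'I_k} =>
     \sum_(e : {ffun ent_edge N -> 'I_d})
       \prod_(v : vertex N)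
         T (x v, e (up_edge v), e (right_edge v), e (down_edge v),
            e (left_edge v))].

Definition zariski_open (R : realType) (I : finType)
    (A : set {ffun I -> R[i]}) : Prop :=
  exists S : set (mpoly.mpoly #|I| R[i]),
    ~` A = [set T | forall p, S p ->
                      mpoly.meval (fun i => T (enum_val i)) p = 0].

(* P holds for a generic element of TNS'(G_{2 x N}, d, k). *)
Definition generic_tns (R : realType) (N d k : nat)
    (P : tensor R (vertex N) k -> Prop) : Prop :=
  exists A : set (site_tensor R d k),
    [/\ zariski_open A, A !=set0 & forall T, A T -> P (tns N T)].

(* Main.v *)
Require Import Defs.
From mathcomp Require Import all_boot all_order all_algebra.
From mathcomp Require Import complex.
From mathcomp Require Import -(notations) mpoly.
From mathcomp Require Import all_classical all_reals all_analysis.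

(** Cut the vertices of the grid into the upper and the lower row and view a
    tensor as a matrix: rows are indexed by basis states of the upper row,
    columns by basis states of the lower row. A rank one tensor becomes a matrix
    of rank at most one, so a tensor of rank r has only vanishing minors of size
    greater than r; since minors are continuous, the same holds for border rank
    r. Hence a nonzero minor of size m forces border rank at least m
    ([border_rank_ge_minor]).

    Each such minor of phi(T) is a polynomial in the entries of T
    ([det_flattening_tns_meval]), so it is nonzero on a Zariski open set of T,
    and a single T on which it does not vanish makes this set nonempty. Such a T
    is the tensor [copy_site]: it forces its physical, up and down indices to
    agree and its horizontal indices to be 0. The grid then falls apart into N
    columns, each carrying the tensor sum_i e_i (x) e_i, and the matrix of the
    resulting tensor is the identity of size 2^N
    ([flattening_tns_copy_site]). So the border rank of a generic tensor is at
    least 2^N, which is stronger than the bound 2^(N-1). *)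

Set Implicit Arguments.
Unset Strict Implicit.
Unset Printing Implicit Defensive.

Import Order.TTheory GRing.Theory Num.Theory.
Import numFieldNormedType.Exports.
Local Open Scope classical_set_scope.
Local Open Scope ring_scope.
Local Open Scope complex_scope.

Lemma least_mem (P : set nat) :
  (exists r, P r) -> P (least P).
Proof.
move=> [r Pr]; rewrite /least.
have exP : exists n, `[< P n >] by exists r; apply/asboolP.
have [n /asboolP Pn nP] := ex_minnP exP.
case: xgetP => [y _ []//|/(_ n)]; case; split=> // l Pl.
by apply/nP/asboolP.
Qed.

Lemma prod_eqb (R : comNzRingType) (I : finType) (P : pred I) :
  \prod_i (P i)%:R = [forall i, P i]%:R :> R.
Proof.
case: forallP => [allP|/forallP]; first by rewrite big1 // => i _; rewrite allP.
by rewrite negb_forall => /existsP[i /negPf Pi]; rewrite (bigD1 i) //= Pi mul0r.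
Qed.

(** The determinant is a polynomial in the entries, hence continuous. *)
Lemma cvg_det (K : numFieldType) m (M : nat -> 'M[K]_m) (M0 : 'M[K]_m) :
  (forall i j, (fun n => M n i j : K^o) @ \oo --> (M0 i j : K^o)) ->
  (fun n => \det (M n) : K^o) @ \oo --> (\det M0 : K^o).
Proof.
move=> cM; apply: cvg_big => [|s _]; first exact: add_continuous.
apply: cvgM; first exact: cvg_cst.
apply: cvg_big => [|i _]; last exact: cM.
exact: mul_continuous.
Qed.

Section Flattening.
Variables (R : realType) (V : finType) (k : nat).
Implicit Types (t : tensor R V k) (B : pred V).

Definition glue B (a b : {ffun V -> 'I_k}) : {ffun V -> 'I_k} :=
  [ffun v => if B v then a v else b v].

Definition flattening B m (f g : 'I_m -> {ffun V -> 'I_k}) t : 'M[R[i]]_m :=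
  \matrix_(i, j) t (glue B (f i) (g j)).

(** The coordinates of a simple tensor are products over the vertices; splitting
    each product along B writes the matrix as a column times a row. *)
Lemma rank_flattening_rank_one B m (f g : 'I_m -> {ffun V -> 'I_k}) t :
  rank_one t -> (\rank (flattening B f g t) <= 1)%N.
Proof.
case=> w ->.
pose c : 'cV[R[i]]_m := \col_i \prod_(v | B v) w v (f i v).
pose r : 'rV[R[i]]_m := \row_j \prod_(v | ~~ B v) w v (g j v).
suff -> : flattening B f g (simple_tensor w) = c *m r.
  by rewrite (leq_trans (mxrankM_maxl _ _)) // rank_leq_col.
apply/matrixP => i j; rewrite !mxE big_ord1 !mxE ffunE (bigID B) /=.
congr (_ * _); apply: eq_bigr => v Bv; rewrite ffunE ?Bv //.
by rewrite (negPf Bv).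
Qed.

Lemma rank_flattening_sum B m (f g : 'I_m -> {ffun V -> 'I_k}) r
    (s : 'I_r -> tensor R V k) :
  (forall i, rank_one (s i)) ->
  (\rank (flattening B f g (\sum_(i < r) s i)%R) <= r)%N.
Proof.
move=> s1.
have -> : flattening B f g (\sum_(i < r) s i) =
    \sum_(i < r) flattening B f g (s i).
  apply/matrixP => i j; rewrite mxE summxE sum_ffunE.
  by apply: eq_bigr => l _; rewrite mxE.
elim: r s s1 => [|r IH] s s1; first by rewrite big_ord0 mxrank0.
rewrite big_ord_recr /=; apply: leq_trans (mxrank_add _ _) _.
rewrite -[leqRHS]addn1 leq_add //; first exact: IH.
exact: rank_flattening_rank_one.
Qed.

(** Expand t in the basis of simple tensors. The coefficient has to be absorbed
    into the factor at some vertex v0, and for V empty the claim is false: then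
    1 is the only rank one tensor. *)
Lemma sum_of_rank_one (v0 : V) t :
  exists r, exists s : 'I_r -> tensor R V k,
    (forall i, rank_one (s i)) /\ t = \sum_(i < r) s i.
Proof.
pose w (e : {ffun V -> 'I_k}) v : {ffun 'I_k -> R[i]} :=
  [ffun a => (if v == v0 then t e else 1) * (e v == a)%:R].
have wE e x : simple_tensor (w e) x = t e * (e == x)%:R.
  rewrite ffunE; under eq_bigr do rewrite ffunE.
  rewrite big_split /= prod_eqb; congr (_ * _%:R).
    by rewrite -big_mkcond big_pred1_eq.
  by congr nat_of_bool; apply/forallP/eqP => [ex|-> //]; apply/ffunP => v; apply/eqP.
exists #|{ffun V -> 'I_k}|, (fun i => simple_tensor (w (enum_val i))); split.
  by move=> i; eexists.
rewrite -(big_enum_val (fun e => simple_tensor (w e))) /=.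
apply/ffunP => x; rewrite sum_ffunE (bigD1 x) //= wE eqxx mulr1 big1 ?addr0 //.
by move=> e /negPf ex; rewrite wE ex mulr0.
Qed.

Lemma rank_flattening_tensor_rank (v0 : V) B m (f g : 'I_m -> {ffun V -> 'I_k}) t :
  (\rank (flattening B f g t) <= tensor_rank t)%N.
Proof.
have [s [s1 {1}->]] := least_mem (sum_of_rank_one v0 t).
exact: rank_flattening_sum.
Qed.

(** If the border rank r were less than m, then t would be a limit of tensors of
    rank r, whose minors of size m all vanish, and so the minor of t would be a
    limit of zeros. *)
Lemma border_rank_ge_minor (v0 : V) B m (f g : 'I_m -> {ffun V -> 'I_k}) t :
  \det (flattening B f g t) != 0 -> (m <= border_rank t)%N.
Proof.
move=> det_neq0.
have [|s [rks slim]] := @least_mem [set r | exists s : nat -> tensor R V k,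
    (forall n, tensor_rank (s n) = r) /\ tensor_limit s t].
  by exists (tensor_rank t), (fun=> t); split=> // x; exact: cvg_cst.
rewrite leqNgt; apply: contraNN det_neq0 => lt_m.
have det0 n : \det (flattening B f g (s n)) = 0.
  apply/eqP; apply: contraLR lt_m => det_neq0; rewrite -leqNgt.
  have := rank_flattening_tensor_rank v0 B f g (s n).
  by rewrite rks mxrank_unit // unitmxE unitfE.
have lim_det : (fun=> 0 : R[i]^o) @ \oo --> (\det (flattening B f g t) : R[i]^o).
  have -> : (fun=> 0) = (fun n => \det (flattening B f g (s n))).
    by apply/funext => n; rewrite det0.
  apply: cvg_det => i j; rewrite mxE.
  by under eq_fun do rewrite mxE; exact: slim.
apply/eqP; apply/(cvg_unique (@norm_hausdorff _ R[i]^o) lim_det).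
exact: cvg_cst.
Qed.
End Flattening.

Lemma zariski_open_meval (R : realType) (I : finType)
    (p : mpoly #|I| R[i]) :
  zariski_open [set T : {ffun I -> R[i]} |
    meval (fun i => T (enum_val i)) p != 0].
Proof.
exists [set p]; apply/seteqP; split => T /=.
  by move=> /negP/negPn/eqP pT0 _ ->.
by move=> /(_ p erefl) ->; rewrite eqxx.
Qed.

(** Contract the network with the variable X_c in place of the entry of T at c:
    evaluation at T is a ring morphism and commutes with contraction and with the
    determinant. *)
Lemma det_flattening_tns_meval (R : realType) N d k (B : pred (vertex N)) m
    (f g : 'I_m -> {ffun vertex N -> 'I_k}) :
  exists p : mpoly #|{: site_index d k}| R[i], forall T : site_tensor R d k,
    meval (fun i => T (enum_val i)) p = \det (flattening B f g (tns N T)).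
Proof.
pose X (c : site_index d k) : mpoly #|{: site_index d k}| R[i] :=
  mpolyX R[i] (mnm1 (enum_rank c)).
exists (\det (\matrix_(i, j) \sum_(e : {ffun ent_edge N -> 'I_d})
  \prod_(v : vertex N)
    X (glue B (f i) (g j) v, e (up_edge v), e (right_edge v), e (down_edge v),
       e (left_edge v)))) => T.
rewrite -det_map_mx; congr (\det _); apply/matrixP => i j.
rewrite !mxE ffunE rmorph_sum; apply: eq_bigr => e _.
rewrite rmorph_prod; apply: eq_bigr => v _.
by rewrite /= mevalXU enum_rankK.
Qed.

(** The GHZ tensor on the physical, up and down edges, times e_0 on the
    horizontal edges. *)
Definition copy_site (R : realType) k : site_tensor R k.+1 k.+1 :=
  [ffun c => let: (x, u, r, d, l) := c in
     [&& x == u, x == d, r == ord0 & l == ord0]%:R].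

(** Only one assignment of indices to the edges can contribute to the coordinate
    x: 0 on the horizontal edges and x v on the down edge of v. It does contribute
    exactly when x v also fits the up edge of v, which is the down edge of the
    other vertex in the column. *)
Lemma tns_copy_site (R : realType) N k (x : {ffun vertex N -> 'I_k.+1}) :
  tns N (copy_site R k) x = [forall v : vertex N, x v == x (v.1, ~~ v.2)]%:R.
Proof.
pose e0 : {ffun ent_edge N -> 'I_k.+1} :=
  [ffun a => match a with inl _ => ord0 | inr v => x v end].
rewrite ffunE.
have termE (e : {ffun ent_edge N -> 'I_k.+1}) :
  \prod_(v : vertex N) copy_site R k
      (x v, e (up_edge v), e (right_edge v), e (down_edge v), e (left_edge v))
  = ((e == e0) && [forall v : vertex N, x v == x (v.1, ~~ v.2)])%:R.
  under eq_bigr do rewrite ffunE.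
  rewrite prod_eqb; congr (nat_of_bool _)%:R.
  apply/forallP/andP => [all_e | [/eqP-> /forallP xE] v]; last first.
    by rewrite !ffunE !eqxx !andbT; exact: xE.
  have e_e0 : e = e0.
    apply/ffunP => -[] v; have /and4P[_ /eqP xd /eqP r0 _] := all_e v;
      by rewrite ffunE.
  split; first exact/eqP.
  by apply/forallP => v; have /andP[] := all_e v; rewrite e_e0 ffunE.
under eq_bigr do rewrite termE.
by rewrite (bigD1 e0) //= eqxx big1 ?addr0 // => e /negPf ->.
Qed.

Definition both_rows N k (a : {ffun 'I_N -> 'I_k}) : {ffun vertex N -> 'I_k} :=
  [ffun v => a v.1].

Definition row_index N k (i : 'I_#|{ffun 'I_N -> 'I_k}|) :=
  both_rows (enum_val i).

Definition upper N : pred (vertex N) := fun v => ~~ v.2.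

Lemma flattening_tns_copy_site (R : realType) N k :
  flattening (@upper N) (@row_index N k.+1) (@row_index N k.+1)
    (tns N (copy_site R k)) = 1%:M.
Proof.
apply/matrixP => i j; rewrite !mxE tns_copy_site; congr (nat_of_bool _)%:R.
apply/forallP/eqP => [eq_rows | -> v]; last by rewrite !ffunE !if_same.
apply/enum_val_inj/ffunP => p.
by have /eqP := eq_rows (p, false); rewrite !ffunE.
Qed.

Lemma generic_border_rank (R : realType) N k : (0 < N)%N ->
  @generic_tns R N k.+1 k.+1 (fun t => (k.+1 ^ N <= border_rank t)%N).
Proof.
move=> N_gt0.
have [p pE] := det_flattening_tns_meval R k.+1 (@upper N)
  (@row_index N k.+1) (@row_index N k.+1).
exists [set T | meval (fun i => T (enum_val i)) p != 0]; split.
- exact: zariski_open_meval.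
- by exists (copy_site R k); rewrite /= pE flattening_tns_copy_site det1 oner_eq0.
- move=> T /=; rewrite pE => /(border_rank_ge_minor (Ordinal N_gt0, false)).
  by rewrite card_ffun !card_ord.
Qed.

Theorem theorem1p12 (R : realType) (N : nat) (hN : (2 <= N)%N)
  (hNeven : ~~ odd N) :
  @generic_tns R N 2 2 (fun t => (2 ^ (N - 1) <= border_rank t)%N).
Proof.
have [A [openA neA geA]] := generic_border_rank R 1 (ltnW hN).
exists A; split=> // T /geA; apply: leq_trans.
by rewrite leq_exp2l // leq_subr.
Qed.
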